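(* For every integer $r\ge 4$ there is a constant $c_r$ such that every graph $G$ with maximum degree $\Delta\ge 3$ satisfies $A_r^l(G)\le \Delta^{\lfloor r/2\rfloor} + c_r\Delta^{(r+1)/3}$; that is, $A_r^l(G)\le \Delta^{\lfloor r/2\rfloor} + O(\Delta^{(r+1)/3})$.
   Context: For an integer $r\ge 3$, an $r$-acyclic vertex-coloring of a graph is a proper vertex-coloring in which every cycle $C$ uses at least $\min(|C|,r)$ colors. $A_r^l(G)$, the $r$-acyclic choice number, is the minimum $k$ such that for every assignment of lists of size at least $k$ to the vertices, $G$ has an $r$-acyclic coloring with each vertex colored from its list. *)

(* Defs.v *)
From mathcomp Require Import all_boot.
From mathcomp Require Import finmap.
Set Implicit Arguments. Unset Strict Implicit. Unset Printing Implicit Defensive.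
Local Open Scope fset_scope.

Definition simple_graph (T : finType) (e : rel T) : Prop :=
  symmetric e /\ irreflexive e.

Definition degree (T : finType) (e : rel T) (v : T) : nat := #|[set u | e v u]|.

Definition max_degree (T : finType) (e : rel T) : nat := \max_(v : T) degree e v.

Definition is_graph_cycle (T : finType) (e : rel T) (c : seq T) : Prop :=
  [/\ 3 <= size c, uniq c & cycle e c].

Definition proper_coloring (T : finType) (e : rel T) (f : T -> nat) : Prop :=
  forall u v, e u v -> f u != f v.

Definition r_acyclic_coloring (r : nat) (T : finType) (e : rel T) (f : T -> nat) : Prop :=
  proper_coloring e f /\
  forall c : seq T, is_graph_cycle e c -> minn (size c) r <= size (undup (map f c)).

Definition r_acyclic_choosable (r : nat) (T : finType) (e : rel T) (k : nat) : Prop :=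
  forall L : T -> {fset nat}, (forall v, k <= #|` L v|) ->
  exists f : T -> nat, (forall v, f v \in L v) /\ r_acyclic_coloring r e f.

(* Main.v *)
Require Import Defs.
From mathcomp Require Import all_boot.
From mathcomp Require Import finmap.
From mathcomp Require Import zify.

(** Write [D] for the maximum degree and [d] for [r./2], and pick [B] of order
    [D ^ ((r + 1) / 3)]. Requiring vertices at distance at most [d] to get
    different colours costs at most [D ^ d] colours per vertex and makes cycles
    of length at most [r] (at most [r + 1] if [r] is even) rainbow. Also forbid
    equal colours on the at most [B] vertices [u] joined to [v] by more than
    [D ^ d.+1 / B] walks of length [d.+1]; then, for odd [r], few cycles of length
    [r + 1] through [v] can have [v] and its antipode of the same colour. With these
    constraints at most [B ^ (l - r + 1)] cycles of length [l] through a vertex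
    can be spoiled by colouring it.

    Rosenfeld's counting argument then shows that colouring one more vertex
    multiplies the number of good partial list colourings by at least
    [beta = 2 * r ^ (r + 1) * B]. A spoiled cycle of length [l] has [l - r + 1]
    vertices, the new one included, whose colours are read off other vertices of
    the cycle according to one of [r ^ l] patterns; erasing them divides the
    number of colourings by [beta ^ (l - r)]. *)

Set Implicit Arguments.
Unset Strict Implicit.
Unset Printing Implicit Defensive.

(** * Counting tools and repetitions in sequences *)

Lemma card_fibers (A B : finType) (X : {set A}) (h : A -> B) :
  #|X| = \sum_(b : B) #|[set a in X | h a == b]|.
Proof.
rewrite -sum1_card (partition_big h xpredT) //; apply: eq_bigr => b _.
by rewrite -sum1_card; apply: eq_bigl => a; rewrite inE.
Qed.

Lemma leq_card_inj_in (A B : finType) (h : A -> B) (X : {set A}) (Y : {set B}) :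
  {in X &, injective h} -> {in X, forall a, h a \in Y} -> #|X| <= #|Y|.
Proof.
move=> hinj hY; rewrite -(card_in_imset hinj); apply: subset_leq_card.
by apply/subsetP => _ /imsetP[a aX ->]; apply: hY.
Qed.

Lemma leq_card_bigcup (A B : finType) (P : pred A) (F : A -> {set B}) :
  #|\bigcup_(a | P a) F a| <= \sum_(a | P a) #|F a|.
Proof.
elim/big_rec2: _ => [|a n X _ IH]; first by rewrite cards0.
by apply: leq_trans (leq_card_setU _ _).1 _; rewrite leq_add2l.
Qed.

Lemma geometric_sum (b : nat -> nat) A r n :
  (forall l, r < l -> b l * 2 ^ (l - r) <= A) -> \sum_(l < n | r < l) b l <= A.
Proof.
move=> hb; case: n => [|n]; first by rewrite big_ord0.
(* The invariant for the induction is that the sum is at most [A * (1 - 2 ^ -(n - r))], with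
   denominators cleared; the summand [A] is the missing tail. *)
suff : (\sum_(l < n.+1 | r < l) b l) * 2 ^ (n - r) + A <= A * 2 ^ (n - r).
  have : 0 < 2 ^ (n - r) by rewrite expn_gt0.
  set p := 2 ^ _; set s := \sum_(_ < _ | _) _; nia.
elim: n => [|n IHn]; first by rewrite big_mkcond big_ord1 sub0n !muln1.
rewrite big_mkcond big_ord_recr -big_mkcond /=; have [rn | nr] := ltnP r n.+1; last first.
  have E : n.+1 - r = n - r by lia.
  by rewrite addn0 E.
move: (hb _ rn) IHn; rewrite subSn // expnS.
move: (2 ^ _) (\sum_(_ < _ | _) _) (b _) => p s t; rewrite !(mulnDl, mulnCA _ 2). lia.
Qed.

(** The number of repetitions [size s - size (undup s)] is monotone under subsequences; the additive
    form avoids truncated subtraction. *)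
Lemma subseq_repetitions (A : eqType) (s1 s2 : seq A) : subseq s1 s2 ->
  size s1 + size (undup s2) <= size s2 + size (undup s1).
Proof.
elim: s2 s1 => [|x s2 IH] [|y s1] //= sub12.
- by rewrite addn0; have := size_undup (x :: s2).
- have [yx | nyx] := eqVneq y x; last first.
    rewrite (negbTE nyx) in sub12; have /= := IH _ sub12.
    by do 2?case: ifP => /=; lia.
  rewrite yx eqxx in sub12 *; have := IH _ sub12.
  have : x \in s1 -> x \in s2 by apply: mem_subseq.
  case: (x \in s1); case: (x \in s2) => /=; [lia|by move=> /(_ isT)|lia|lia].
Qed.

(** A coloured entry is redundant exactly when it occurs again later; these positions become the set
    [repeats] of a pattern. *)
Lemma size_pmap_undup (A : eqType) (s : seq (option A)) :
  size (pmap id s) = size (undup (pmap id s)) +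
    \sum_(0 <= i < size s) (isSome (nth None s i) && (nth None s i \in drop i.+1 s)).
Proof.
elim: s => [|[a|] s IH] /=; first by rewrite big_geq.
- rewrite big_nat_recl //= drop0.
  have -> : (Some a \in s) = (a \in pmap id s) by rewrite mem_pmap map_id.
  by case: ifP => _ /=; rewrite {1}IH ?add1n ?addnS ?add0n ?addSn.
- by rewrite big_nat_recl.
Qed.

(** * Walks, balls and risky cycles *)

Section Walks.

Variables (T : finType) (e : rel T) (D : nat).
Hypothesis esym : symmetric e.
Hypothesis eirr : irreflexive e.
Hypothesis degD : forall v, degree e v <= D.

Lemma card_paths n u : #|[set s : n.-tuple T | path e u s]| <= D ^ n.
Proof.
elim: n u => [|n IHn] u.
  by apply: leq_trans (max_card _) _; rewrite card_tuple.
rewrite (card_fibers _ (@thead n T)).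
apply: (@leq_trans (\sum_(x in [set x | e u x]) D ^ n)); last first.
  by rewrite sum_nat_const expnS leq_mul2r degD orbT.
rewrite [leqRHS]big_mkcond; apply: leq_sum => x _; rewrite inE.
have [eux | neux] := ifP; last first.
  rewrite leqn0 cards_eq0 -subset0; apply/subsetP => s.
  case/tupleP: s => y s; rewrite !inE theadE /= => /andP[/andP[euy _] /eqP yx].
  by rewrite -yx euy in neux.
apply: leq_trans (IHn x).
apply: (@leq_card_inj_in _ _ (fun s : n.+1.-tuple T => [tuple of behead s])).
- move=> s t; rewrite !inE => /andP[_ /eqP sx] /andP[_ /eqP tx] /(congr1 val) /= st.
  by rewrite [s]tuple_eta [t]tuple_eta; apply: val_inj; rewrite /= sx tx st.
- by case/tupleP => y s; rewrite !inE theadE /= => /andP[/andP[_ ps] /eqP <-].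
Qed.

Definition walks n u v : {set n.-tuple T} :=
  [set s : n.-tuple T | path e u s && (last u s == v)].

Lemma sum_walks n u : \sum_v #|walks n u v| <= D ^ n.
Proof.
apply: leq_trans (card_paths n u); rewrite (card_fibers _ (fun s : n.-tuple T => last u s)).
by apply: leq_sum => v _; apply: subset_leq_card; apply/subsetP => s; rewrite !inE.
Qed.

Lemma rev_walk (u : T) s : path e u s ->
  path e (last u s) (rev (belast u s)) /\ last (last u s) (rev (belast u s)) = u.
Proof.
move=> pus; split; first by rewrite rev_path (eq_path (e' := e)).
by case: s {pus} => //= x s; rewrite rev_cons last_rcons.
Qed.

Lemma card_walks_le n u v : #|walks n u v| <= #|walks n v u|.
Proof.
have sz (s : n.-tuple T) : size (rev (belast u s)) == n.
  by rewrite size_rev size_belast size_tuple.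
apply: (@leq_card_inj_in _ _ (fun s => Tuple (sz s))).
- move=> s t;
  rewrite !inE => /andP[_ /eqP su] /andP[_ /eqP tu] /(congr1 val) /= /(can_inj (@revK T)) st.
  apply: val_inj => /=; have := lastI u s; rewrite st su -tu -lastI.
  by case.
- by move=> s; rewrite !inE => /andP[/rev_walk[+ +] /eqP sv] /=; rewrite sv => -> ->; rewrite eqxx.
Qed.

Lemma card_walksC n u v : #|walks n u v| = #|walks n v u|.
Proof. by apply/eqP; rewrite eqn_leq !card_walks_le. Qed.

Fixpoint ball d v : {set T} :=
  if d is d'.+1 then v |: \bigcup_(x in [set x | e v x]) ball d' x else [set v].

Lemma ballP d u v :
  reflect (exists2 p, path e u p & (last u p == v) && (size p <= d)) (v \in ball d u).
Proof.
elim: d u => [|d IHd] u.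
  rewrite inE; apply: (iffP eqP) => [-> | [[|x p] _ /= /andP[/eqP //]]].
  by exists [::]; rewrite //= eqxx.
rewrite !inE; apply: (iffP orP) => [[/eqP-> | /bigcupP[x]] | [[|x p] /=]].
- by exists [::]; rewrite //= eqxx.
- by rewrite inE => eux /IHd[p px Hp]; exists (x :: p); rewrite //= eux.
- by move=> _ /andP[/eqP-> _]; left.
- move=> /andP[eux px] Hp; right; apply/bigcupP; exists x; rewrite ?inE //.
  by apply/IHd; exists p.
Qed.

Lemma ball_sym d u v : (v \in ball d u) = (u \in ball d v).
Proof.
suff imp w x : x \in ball d w -> w \in ball d x by apply/idP/idP; apply: imp.
case/ballP => p /rev_walk[pp lp] /andP[/eqP E szp]; apply/ballP.
by exists (rev (belast w p)); rewrite -E // lp eqxx size_rev size_belast.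
Qed.

(* Removing from the ball around each neighbour both its centre and [v] is what
   keeps the leading constant equal to 1. *)
Lemma card_punctured_ball d v : 0 < d -> #|ball d v :\ v| <= D ^ d.
Proof.
case: d => // d _; elim: d v => [|d IHd] v.
  rewrite expn1; apply: leq_trans (degD v); apply: subset_leq_card.
  apply/subsetP => x; rewrite !inE => /andP[/negbTE -> /=] /bigcupP[y].
  by rewrite !inE => evy /eqP ->.
apply: (@leq_trans #|[set x | e v x] :|:
    \bigcup_(x in [set x | e v x]) (ball d.+1 x :\ x :\ v)|).
  apply: subset_leq_card; apply/subsetP => y; rewrite !inE => /andP[yv].
  rewrite (negbTE yv) /= => /bigcupP[x ex yx].
  have [yx' | nyx] := eqVneq y x; first by move: ex; rewrite inE yx' => ->.
  by apply/orP; right; apply/bigcupP; exists x; rewrite // in_setD1 yv in_setD1 nyx.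
apply: leq_trans (leq_card_setU _ _).1 _.
have hx x : e v x -> #|ball d.+1 x :\ x :\ v| <= (D ^ d.+1).-1.
  move=> evx; have := IHd x; rewrite (cardsD1 v (_ :\ x)).
  suff -> : v \in ball d.+1 x :\ x by rewrite add1n; lia.
  rewrite in_setD1; apply/andP; split.
    by apply: contraTneq evx => ->; rewrite eirr.
  by apply/ballP; exists [:: v]; rewrite /= ?eqxx // esym evx.
have hN : #|[set x | e v x]| <= D by apply: degD.
have [D0 | Dpos] := posnP D.
  have E : [set x | e v x] = set0 by apply/eqP; rewrite -cards_eq0; lia.
  by rewrite E big_set0 cards0.
have hU : #|\bigcup_(x in [set x | e v x]) (ball d.+1 x :\ x :\ v)| <= D * (D ^ d.+1).-1.
  apply: leq_trans (leq_card_bigcup _ _) _.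
  apply: leq_trans (leq_mul hN (leqnn _)); rewrite -sum_nat_const.
  by apply: leq_sum => x; rewrite inE => /hx.
(* At most [D] neighbours and [D * (D ^ d.+1 - 1)] further vertices make [D ^ d.+2] in all. *)
have : 0 < D ^ d.+1 by rewrite expn_gt0 Dpos.
rewrite [D ^ d.+2]expnS; nia.
Qed.

(** * Crowded pairs, conflicts and risky cycles *)

Variables (r B : nat).
Let d := r./2.

Definition crowded u v := D ^ d.+1 < #|walks d.+1 u v| * B.

Lemma crowded_sym u v : crowded u v = crowded v u.
Proof. by rewrite /crowded card_walksC. Qed.

(** Markov's inequality: at most [D ^ d.+1] walks leave [u], and each crowded endpoint takes more
    than a fraction [1 / B] of that bound. *)
Lemma card_crowded u : 0 < D -> #|[set v | crowded u v]| <= B.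
Proof.
move=> D0; have M0 : 0 < D ^ d.+1 by rewrite expn_gt0 D0.
rewrite -(leq_pmul2r M0) -sum_nat_const.
apply: (@leq_trans (\sum_(v in [set v | crowded u v]) #|walks d.+1 u v| * B)).
  by apply: leq_sum => v; rewrite inE => /ltnW.
rewrite -big_distrl /= [leqRHS]mulnC leq_mul2r; apply/orP; right.
apply: leq_trans (sum_walks d.+1 u).
by rewrite big_mkcond; apply: leq_sum => v _; case: ifP.
Qed.

Definition conflict u v := (u != v) && ((v \in ball d u) || crowded u v).

Lemma conflict_sym : symmetric conflict.
Proof. by move=> u v; rewrite /conflict eq_sym ball_sym crowded_sym. Qed.

Lemma card_conflict u : 0 < d -> 0 < D -> #|[set v | conflict u v]| <= D ^ d + B.
Proof.
move=> d0 D0; apply: (@leq_trans #|ball d u :\ u :|: [set v | crowded u v]|).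
  apply: subset_leq_card; apply/subsetP => v; rewrite !inE eq_sym.
  by case/andP => -> /orP[-> | ->]; rewrite ?orbT.
apply: leq_trans (leq_card_setU _ _).1 _.
by rewrite leq_add ?card_punctured_ball ?card_crowded.
Qed.

(* The cycles through [v], as tuples starting at [v], that a repetition of the colour
   of [v] can spoil; for [l = r.+1] the repetition is at the antipode of [v], which sits
   at index [d.+1]. *)
Definition risky_cycles l v : {set l.-tuple T} :=
  [set c : l.-tuple T | [&& cycle e c, ohead c == Some v &
    (l == r.+1) ==> odd r && ~~ crowded v (nth v c d.+1)]].

(** The [l - 1] free vertices give [D ^ (l - 1)] choices. After cubing,
    [3 * (l - 1) <= (r + 1) * (l - r + 1)] suffices; it is tight at [l = r + 2] and fails at
    [l = r + 1] once [r > 2], so that length is treated separately. *)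
Lemma card_risky_long l v : 2 <= r -> 0 < D -> D ^ r.+1 <= B ^ 3 -> r.+1 < l ->
  #|risky_cycles l v| <= B ^ (l - r).+1.
Proof.
case: l => [|l] // r2 D0 DB rl; apply: (@leq_trans (D ^ l)).
  apply: leq_trans (card_paths l v).
  apply: (@leq_card_inj_in _ _ (fun s : l.+1.-tuple T => [tuple of behead s])).
  - move=> s t; case/tupleP: s => x s; case/tupleP: t => y t; rewrite !inE /=.
    move=> /and3P[_ /eqP[->] _] /and3P[_ /eqP[->] _] /(congr1 val) /= st.
    by apply: val_inj; rewrite /= st.
  - case/tupleP => x s; rewrite !inE /= => /and3P[ps /eqP[xv] _].
    by move: ps; rewrite xv rcons_path => /andP[].
rewrite -(@leq_exp2r _ _ 3) // -!expnM mulnC.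
apply: (@leq_trans (D ^ (r.+1 * (l.+1 - r).+1))).
  by rewrite leq_pexp2l //; nia.
by rewrite expnM [_ * 3]mulnC [B ^ _]expnM leq_exp2r.
Qed.

(** The antipode [u] cuts the cycle into a walk from [v] to [u] and one back, both of length [d.+1].
    As [u] is not crowded, the way back has at most [D ^ d.+1 / B] choices, so the total is at most
    [D ^ r.+1 / B]. *)
Lemma card_risky_short v : odd r -> 0 < B -> D ^ r.+1 <= B ^ 3 ->
  #|risky_cycles r.+1 v| <= B ^ 2.
Proof.
move=> rodd B0 DB; have Er : r.+1 = d.+1 + d.+1 by have := odd_double_half r; rewrite rodd /d; lia.
(* A walk is listed without its start, so [v] is rotated to the end before the cycle is halved. *)
have sz1 (c : r.+1.-tuple T) : size (take d.+1 (rot 1 c)) == d.+1.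
  by rewrite size_takel // size_rot size_tuple Er leq_addr.
have sz2 (c : r.+1.-tuple T) : size (drop d.+1 (rot 1 c)) == d.+1.
  by rewrite size_drop size_rot size_tuple Er addnK.
apply: (@leq_trans #|\bigcup_(u | ~~ crowded v u) setX (walks d.+1 v u) (walks d.+1 u v)|).
  apply: (@leq_card_inj_in _ _ (fun c => (Tuple (sz1 c), Tuple (sz2 c)))).
    move=> s t _ _ [st1 st2]; apply/val_inj/(@rot_inj 1).
    by rewrite -[LHS](cat_take_drop d.+1) st1 st2 cat_take_drop.
  move=> c; rewrite inE eqxx rodd /= => /and3P[].
  have [t Et] : exists t, ohead c == Some v -> tval c = v :: t.
    by case: (tval c) => [|x t]; [exists [::] | exists t => /eqP[->]].
  move=> + /Et{}Et; have szt : size t = (d + d).+1.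
    by have := size_tuple c; rewrite Et /=; lia.
  set u := nth v c d.+1 => cc nu; apply/bigcupP; exists u => //.
  have Erot : rot 1 c = rcons t v by rewrite Et rot1_cons.
  have mid : last v (take d.+1 (rcons t v)) = u.
    rewrite (last_nth v) size_takel; last by rewrite size_rcons szt; lia.
    by rewrite /= nth_take // nth_rcons szt ltnS leq_addr /u Et.
  have end_v : last u (drop d.+1 (rcons t v)) = v.
    by rewrite -[in RHS](last_rcons v t v)
      -[in RHS](cat_take_drop d.+1 (rcons t v)) last_cat mid.
  have : path e v (rcons t v) by move: cc; rewrite Et.
  rewrite -[in X in X -> _](cat_take_drop d.+1 (rcons t v)) cat_path mid => /andP[p1 p2].
  by rewrite !inE /= !Erot p1 p2 mid end_v !eqxx.
apply: leq_trans (leq_card_bigcup _ _) _.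
rewrite -(leq_pmul2r B0) big_distrl /=.
apply: (@leq_trans (\sum_u #|walks d.+1 v u| * D ^ d.+1)).
  rewrite big_mkcond; apply: leq_sum => u _; case: ifP => //; rewrite -leqNgt => Hu.
  by rewrite cardsX -mulnA leq_mul2l [#|walks _ u v|]card_walksC Hu orbT.
rewrite -big_distrl /= -expnSr; apply: leq_trans DB.
by rewrite Er expnD leq_mul2r sum_walks orbT.
Qed.

Lemma card_risky_cycles l v : 2 <= r -> 0 < B -> 0 < D -> D ^ r.+1 <= B ^ 3 -> r < l ->
  #|risky_cycles l v| <= B ^ (l - r).+1.
Proof.
move=> r2 B0 D0 DB; rewrite leq_eqVlt => /predU1P[<- | ]; last exact: card_risky_long.
rewrite subSnn; have [rodd | reven] := boolP (odd r); first exact: card_risky_short.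
suff -> : risky_cycles r.+1 v = set0 by rewrite cards0.
by apply/setP => c; rewrite !inE eqxx (negbTE reven) !andbF.
Qed.

(** * Counting partial colourings *)

Section Counting.

Variables (K : finType) (L : T -> {set K}).

Local Notation pcol := {ffun T -> option K}.
Implicit Types (f : pcol) (S : {set T}).

(* An uncoloured vertex counts as having a colour of its own, so that colouring
   one more vertex violates this condition only if it repeats a colour. *)
Definition repetitive f (c : seq T) :=
  size (undup (pmap f c)) + (size c - r) < size (pmap f c).

(** Bounding the length by [#|T|] makes the condition boolean and loses nothing, since the cycles
    considered are duplicate-free. *)
Definition good f :=
  [forall u, forall v, conflict u v ==> (f u == f v) ==> (f u == None)] &&
  [forall l : 'I_#|T|.+1, forall c : l.-tuple T, cycle e c ==> uniq c ==> ~~ repetitive f c].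

Lemma goodP f : reflect
  ((forall u v, conflict u v -> f u = f v -> f u = None) /\
   (forall c, cycle e c -> uniq c -> ~~ repetitive f c)) (good f).
Proof.
apply: (iffP andP) => -[H1 H2]; split.
- by move=> u v uv E; move/forallP/(_ u)/forallP/(_ v): H1; rewrite uv E eqxx /= => /eqP.
- move=> c ce cu; have szc : size c < #|T|.+1 by rewrite ltnS -(card_uniqP cu) max_card.
  by move/forallP/(_ (Ordinal szc))/forallP/(_ (in_tuple c)): H2; rewrite /= ce cu.
- apply/forallP => u; apply/forallP => v; apply/implyP => uv; apply/implyP => /eqP E.
  by apply/eqP; apply: H1 E.
- by apply/forallP => l; apply/forallP => c; apply/implyP => ce; apply/implyP; apply: H2.
Qed.

Definition restr S f : pcol := [ffun x => if x \in S then f x else None].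

Lemma restr_subset S S' f : S' \subset S -> restr S' (restr S f) = restr S' f.
Proof.
move=> /subsetP S'S; apply/ffunP => x; rewrite !ffunE.
by case: ifP => // /S'S ->.
Qed.

(** Erasing colours cannot create a repetition, and the length of the cycle is unchanged. *)
Lemma good_restr S f : good f -> good (restr S f).
Proof.
move=> /goodP[H1 H2]; apply/goodP; split=> [u v uv | c ce cu].
  rewrite !ffunE; case: ifP => // _; case: ifP => // _; exact: H1.
move: (H2 c ce cu); apply: contraNN; rewrite /repetitive.
have /subseq_repetitions : subseq (pmap (restr S f) c) (pmap f c).
  elim: c {ce cu} => //= x c IH; rewrite ffunE; case: ifP => _; case: (f x) => //= a.
    by rewrite eqxx.
  exact: subseq_trans IH (subseq_cons _ _).
have arith p q m n k : p + q <= m + n -> n + k < p -> q + k < m by lia.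
exact: arith.
Qed.

(** * Partial list colourings and their extensions by one vertex *)

Definition valid S f :=
  [forall x, if f x is Some a then (x \in S) && (a \in L x) else x \notin S].

Lemma valid_support S f x : valid S f -> isSome (f x) = (x \in S).
Proof.
by move=> /forallP/(_ x); case: (f x) => [a /andP[-> _] | /negbTE ->].
Qed.

Lemma valid_list S f x a : valid S f -> f x = Some a -> a \in L x.
Proof. by move=> /forallP/(_ x) + E; rewrite E => /andP[]. Qed.

Lemma valid_restr S S' f : S' \subset S -> valid S f -> valid S' (restr S' f).
Proof.
move=> /subsetP S'S vf; apply/forallP => x; rewrite ffunE; case: ifP => [xS' | /negbT //].
have := valid_support x vf; rewrite (S'S _ xS'); case E: (f x) => [a|] // _.
by rewrite (valid_list vf E).
Qed.

Definition pcolorings S := [set f : pcol | good f && valid S f].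

(** All ways to colour [v] after a good colouring of [S]; the bad ones are subtracted later. *)
Definition extensions S v := [set f : pcol | good (restr S f) && valid (v |: S) f].

Lemma card_extensions S v : v \notin S -> #|pcolorings S| * #|L v| <= #|extensions S v|.
Proof.
move=> vS; rewrite -cardsX.
pose ext (p : pcol * K) : pcol := [ffun x => if x == v then Some p.2 else p.1 x].
have rext p : p \in setX (pcolorings S) (L v) -> restr S (ext p) = p.1.
  rewrite !inE => /andP[/andP[_ vp] _]; apply/ffunP => x; rewrite !ffunE.
  have := valid_support x vp; case: ifP => [xS _|_]; last by case: (p.1 x).
  by case: eqP => // xv; rewrite -xv xS in vS.
apply: (@leq_card_inj_in _ _ ext).
  move=> p q pX qX pq; have := rext p pX; rewrite pq rext // => p1.
  move/ffunP/(_ v): pq; rewrite !ffunE eqxx => -[p2].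
  by case: p q p1 p2 {pX qX} => p1 p2 [q1 q2] /= -> ->.
move=> p pX; rewrite inE rext //; move: pX; rewrite !inE => /andP[/andP[-> vp] pL] /=.
apply/forallP => x; rewrite ffunE !inE; case: eqP => [-> // | _] /=.
by move/forallP: vp.
Qed.

(** The colour of [v] can be read off [u], so erasing it is injective. *)
Lemma card_conflicting_extensions S v u : v \notin S -> u != v ->
  #|[set f in extensions S v | f u == f v]| <= #|pcolorings S|.
Proof.
move=> vS uv; apply: (@leq_card_inj_in _ _ (restr S)).
  move=> f h; rewrite !inE => /andP[/andP[_ vf] /eqP fuv] /andP[/andP[_ vh] /eqP huv] E.
  have fhS x : x \in S -> f x = h x by move=> xS; move/ffunP/(_ x): E; rewrite !ffunE xS.
  have uS : u \in S.
    by have := valid_support u vf; rewrite fuv (valid_support v vf) !inE eqxx (negbTE uv).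
  apply/ffunP => x; have [/fhS // | xS] := boolP (x \in S).
  have [-> | xv] := eqVneq x v; first by rewrite -fuv -huv fhS.
  have := valid_support x vf; have := valid_support x vh.
  by rewrite !inE (negbTE xS) (negbTE xv); case: (f x); case: (h x).
move=> f; rewrite !inE => /andP[/andP[-> vf] _] /=.
by apply: valid_restr vf; apply: subsetUr.
Qed.

Lemma extension_proper S v f : f \in extensions S v ->
  (forall u, conflict v u -> f u != f v) ->
  forall u w, conflict u w -> f u = f w -> f u = None.
Proof.
rewrite inE => /andP[/goodP[H _] vf] nv u w uw fuw.
have [uv | uv] := eqVneq u v; first by have := nv w; rewrite -uv -fuw eqxx => /(_ uw).
have [wv | wv] := eqVneq w v.
  by have := nv u; rewrite -wv -fuw eqxx conflict_sym => /(_ uw).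
have out x : x != v -> restr S f x = f x.
  move=> xv; rewrite ffunE; case: ifP => // xS; have := valid_support x vf.
  by rewrite !inE (negbTE xv) xS; case: (f x).
by have := H u w uw; rewrite !out //; apply.
Qed.

Lemma extension_repetitive S v f : v \notin S -> f \in extensions S v ->
  (forall u, conflict v u -> f u != f v) -> ~~ good f ->
  exists t, [/\ uniq (v :: t), cycle e (v :: t), repetitive f (v :: t) & f v \in map f t].
Proof.
move=> vS fE nv; have Hp := extension_proper fE nv; rewrite /good negb_and => /orP[|].
  case/forallPn => u /forallPn[w]; rewrite !negb_imply => /and3P[uw /eqP E].
  by rewrite (Hp u w uw E).
case/forallPn => l /forallPn[c]; rewrite !negb_imply => /and4P[ce cu crep _].
move: fE; rewrite inE => /andP[/goodP[_ nrep] vf].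
have out x : x != v -> f x = restr S f x.
  move=> xv; rewrite ffunE; case: ifP => // xS; have := valid_support x vf.
  by rewrite !inE (negbTE xv) xS; case: (f x).
have eq_pm s : v \notin s -> pmap f s = pmap (restr S f) s.
  elim: s => //= x s IH; rewrite inE negb_or eq_sym => /andP[xv /IH ->].
  by rewrite out.
(* A cycle avoiding [v] was already repetitive before [v] was coloured. *)
have vc : v \in (c : seq T).
  apply/negPn/negP => vc; have := nrep _ ce cu.
  by rewrite /repetitive -(eq_pm _ vc) => /negP; apply.
have [i t Et] := rot_to vc; exists t.
have cu' : uniq (v :: t) by rewrite -Et rot_uniq.
have ce' : cycle e (v :: t) by rewrite -Et rot_cycle.
have crep' : repetitive f (v :: t).
  have pc : perm_eq (v :: t) c by rewrite -Et perm_rot.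
  rewrite /repetitive (perm_size pc) (perm_size (perm_pmap f pc)).
  have : pmap f (v :: t) =i pmap f c by apply/perm_mem/perm_pmap.
  by move/perm_undup/perm_size ->.
(* A new colour at [v] would raise the number of coloured vertices and of colours equally, leaving
   the cycle non-repetitive. *)
split=> //; have := nrep _ ce' cu'; move: crep'; rewrite /repetitive.
have := valid_support v vf; rewrite !inE eqxx /=.
have vt : v \notin t by case/andP: cu'.
rewrite ffunE (negbTE vS) -(eq_pm _ vt) /=; case E: (f v) => [a|] //= _.
by rewrite -mem_pmap; case: ifP => // _ /=; rewrite addSn ltnS => ->.
Qed.

(** * Repetitions, risky cycles and colour patterns *)

(** Without a conflict both arcs between [v] and [u] are longer than [d]; [i] is the position of [u]
    when [v] has position 0. *)
Lemma repetition_distance v t u : uniq (v :: t) -> cycle e (v :: t) -> u \in t ->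
  ~~ conflict v u ->
  let i := (index u t).+1 in [/\ d < i, i + d <= size t & ~~ crowded v u].
Proof.
move=> /= /andP[vt _] ce ut; rewrite /conflict.
have -> /= : v != u by apply: contraNneq vt => ->.
rewrite negb_or => /andP[nball ->].
have it : index u t < size t by rewrite index_mem.
have Et : t = rcons (take (index u t) t) u ++ drop (index u t).+1 t.
  by rewrite -[in LHS](cat_take_drop (index u t).+1 t) (take_nth v) // nth_index.
move: ce; rewrite {1}Et rcons_cat cat_path last_rcons => /andP[p1 p2]; split=> //.
- rewrite ltnNge; apply: contra nball => leid; apply/ballP.
  by exists (rcons (take (index u t) t) u);
    rewrite // last_rcons eqxx size_rcons size_takel // ltnW.
- rewrite leqNgt; apply: contra nball => ltd; rewrite ball_sym; apply/ballP.
  exists (rcons (drop (index u t).+1 t) v) => //.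
  rewrite last_rcons eqxx size_rcons size_drop /=.
  have arith p q i : p < i.+1 + q -> i < p -> (p - i.+1).+1 <= q by lia.
  exact: arith.
Qed.

(** Two arcs of length at least [d.+1] force length above [r]. At length [r.+1] both are exactly
    [d.+1], so [r] is odd and [u] is the antipode. *)
Lemma repetition_risky v t u : uniq (v :: t) -> cycle e (v :: t) -> u \in t ->
  ~~ conflict v u -> r < size (v :: t) /\ in_tuple (v :: t) \in risky_cycles (size (v :: t)) v.
Proof.
move=> cu ce ut nconf; have [di id ncr] := repetition_distance cu ce ut nconf.
have Er := odd_double_half r; have rd : r <= d.*2.+1.
  by rewrite /d -[leqLHS]Er -add1n leq_add2r; case: odd.
have arith p q i : q < i.+1 -> i.+1 + q <= p -> q.*2.+1 <= p by lia.
split; first by rewrite ltnS; apply: leq_trans rd (arith _ _ _ di id).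
rewrite inE ce eqxx /=; apply/implyP => /eqP[Er'].
have {}rd : r = d.*2.+1.
  by apply/eqP; rewrite eqn_leq rd -Er' (arith _ _ _ di id).
rewrite rd /= odd_double /=; have -> : d = index u t.
  have arith' p q i : p = q.*2.+1 -> q < i.+1 -> i.+1 + q <= p -> q = i by lia.
  by apply: arith' di id; rewrite Er'.
by rewrite nth_index.
Qed.

(* Class [0] of a pattern collects the uncoloured positions; every other class
   is monochromatic, so that the last position of a class determines the others. *)
Definition repeats l (g : {ffun 'I_l -> 'I_r}) : {set 'I_l} :=
  [set i | (0 < g i) && [exists j : 'I_l, (i < j) && (g j == g i)]].

Definition fits l (c : l.-tuple T) (g : {ffun 'I_l -> 'I_r}) f :=
  [forall i, (0 < g i) == isSome (f (tnth c i))] &&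
  [forall i, forall j, (g i == g j) ==> (f (tnth c i) == f (tnth c j))].

Lemma exists_pattern l (c : l.-tuple T) f : r < l -> repetitive f c ->
  exists g, [/\ fits c g f, l - r < #|repeats g| &
    forall i j : 'I_l, i < j -> f (tnth c i) -> f (tnth c i) = f (tnth c j) -> i \in repeats g].
Proof.
move=> rl; rewrite /repetitive size_tuple => crep.
(* The pattern sends a position to the index of its colour in [s], with [None] at index 0. A
   repetitive cycle has fewer than [r] colours, so indices stay below [r]. *)
pose s := None :: map Some (undup (pmap f c)).
have szs : size s <= r.
  have : size (pmap f c) <= l by rewrite size_pmap -{2}(size_tuple c) count_size.
  rewrite /= size_map; move: crep.
  have arith p q : p + (l - r) < q -> q <= l -> p < r by lia.
  exact: arith.
have fs i : f (tnth c i) \in s.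
  rewrite inE; case E: (f _) => [a|] //=.
  rewrite (mem_map Some_inj) mem_undup mem_pmap -E; apply: map_f; exact: mem_tnth.
have r0 : 0 < r by apply: leq_trans szs.
have idx i : index (f (tnth c i)) s < r by apply: leq_trans szs; rewrite index_mem.
pose g := [ffun i => Ordinal (idx i)].
have gE i j : (g i == g j) = (f (tnth c i) == f (tnth c j)).
  rewrite !ffunE -val_eqE; apply/eqP/eqP => E; last by rewrite /= E.
  by rewrite -[LHS](nth_index None (fs i)) -[RHS](nth_index None (fs j)); congr nth.
have g0 i : (0 < g i) = isSome (f (tnth c i)).
  by rewrite ffunE /=; case: (f _).
exists g; split.
- apply/andP; split; first by apply/forallP => i; rewrite g0.
  by apply/forallP => i; apply/forallP => j; apply/implyP; rewrite gE.
- have := size_pmap_undup (map f c); rewrite size_map size_tuple.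
  have -> : pmap id (map f c) = pmap f c by elim: (tval c) => //= x t ->.
  have -> : \sum_(0 <= i < l) (isSome (nth None (map f c) i) &&
      (nth None (map f c) i \in drop i.+1 (map f c))) = #|repeats g|.
    rewrite big_mkord -sum1_card [RHS]big_mkcond; apply: eq_bigr => i _.
    rewrite inE g0 (nth_map (tnth c i)) ?size_tuple // -tnth_nth.
    have -> : [exists j : 'I_l, (i < j) && (g j == g i)] =
        (f (tnth c i) \in drop i.+1 (map f c)).
      apply/existsP/idP => [[j /andP[ij]] | ].
        rewrite gE => /eqP <-; rewrite (tnth_nth (tnth c i)) -(nth_map _ None) ?size_tuple //.
        rewrite -[j : nat](subnKC ij) -nth_drop mem_nth // size_drop size_map size_tuple.
        by rewrite ltn_sub2r // (leq_ltn_trans ij).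
      case/(nthP None) => k; rewrite size_drop size_map size_tuple ltn_subRL => kl.
      rewrite nth_drop (nth_map (tnth c i)) ?size_tuple // => E.
      exists (Ordinal kl); rewrite gE (tnth_nth (tnth c i) c (Ordinal kl)) E eqxx andbT /=.
      by rewrite addSn ltnS leq_addr.
    by case: (_ && _).
  move: crep.
  have arith p q m : p + (l - r) < q -> q = p + m -> l - r < m by lia.
  exact: arith.
- move=> i j ij fi E; rewrite inE g0 fi /=; apply/existsP; exists j.
  by rewrite ij gE E eqxx.
Qed.

Definition fitting S v l (c : l.-tuple T) (g : {ffun 'I_l -> 'I_r}) :=
  [set f in extensions S v | fits c g f].

(** Given the pattern, the colours on the repeated positions [W] are determined by the others, so
    erasing them is injective. As [v] lies in [W] but not in [S], [S] loses one vertex fewer than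
    [W] has, and by [grow] each lost vertex is worth a factor [beta]. *)
Lemma card_fitting S v l (c : l.-tuple T) g i0 beta : uniq c -> v \notin S ->
  tnth c i0 = v -> i0 \in repeats g -> 0 < beta ->
  (forall S', S' \subset S -> #|pcolorings S'| * beta ^ #|S :\: S'| <= #|pcolorings S|) ->
  #|fitting S v c g| * beta ^ #|repeats g|.-1 <= #|pcolorings S|.
Proof.
move=> cu vS ci0 i0U b0 grow; have tinj : injective (tnth c) by apply/tuple_uniqP.
pose W := [set tnth c i | i in repeats g].
have vW : v \in W by rewrite -ci0; apply: imset_f.
have [-> | [f1]] := set_0Vmem (fitting S v c g); first by rewrite cards0.
(* One fitting colouring is needed to see that [W] consists of coloured vertices. *)
rewrite !inE => /andP[/andP[_ vf1] /andP[/forallP f10 _]].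
have WS : W \subset v |: S.
  apply/subsetP => _ /imsetP[i iU ->]; rewrite -(valid_support _ vf1) -(eqP (f10 i)).
  by move: iU; rewrite inE => /andP[].
have DS : S :\: W \subset S by apply: subsetDl.
apply: leq_trans (grow _ DS); apply: leq_mul; last first.
  rewrite leq_pexp2l // setDDr setDv set0U.
  have -> : S :&: W = W :\ v.
    apply/setP => x; rewrite !inE; have := subsetP WS x; rewrite !inE.
    case: eqP => [-> | _] /=; first by rewrite (negbTE vS).
    by case: (x \in W); rewrite ?andbF // => ->.
  by rewrite -(card_imset _ tinj) (cardsD1 v) vW.
apply: (@leq_card_inj_in _ _ (restr (S :\: W))); last first.
  move=> f; rewrite !inE => /andP[/andP[gf vf] _]; rewrite -(restr_subset f DS) good_restr //=.
  rewrite restr_subset //; apply: valid_restr vf.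
  exact: subset_trans DS (subsetUr _ _).
move=> f h; rewrite !inE => /andP[/andP[_ vf] /andP[/forallP f0 /forallP fE]].
move=> /andP[/andP[_ vh] /andP[_ /forallP hE]] Efh.
have onS' x : x \in S :\: W -> f x = h x by move=> xS; move/ffunP/(_ x): Efh; rewrite !ffunE xS.
have fc i j : g i = g j -> f (tnth c i) = f (tnth c j).
  by move=> E; move/forallP/(_ j): (fE i); rewrite E eqxx => /eqP.
have hc i j : g i = g j -> h (tnth c i) = h (tnth c j).
  by move=> E; move/forallP/(_ j): (hE i); rewrite E eqxx => /eqP.
have colored x : x \notin W -> x \in v |: S -> f x = h x.
  move=> xW; rewrite in_setU1 => /predU1P[xv | xS]; first by rewrite -xv (negbTE xW) in vW.
  by apply: onS'; rewrite inE xW.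
apply/ffunP => x; have [xS | xS] := boolP (x \in v |: S); last first.
  have := valid_support x vf; have := valid_support x vh.
  by rewrite (negbTE xS); case: (f x); case: (h x).
have [/imsetP[i] | ] := boolP (x \in W); last by move=> xW; apply: colored.
rewrite inE => /andP[gi _] ->.
(* The last position of the class of [i] is not repeated, so its vertex keeps its colour. *)
case: (@arg_maxnP _ i (fun j => g j == g i) val (eqxx _)) => j /eqP gj jmax.
rewrite -(fc j i gj) -(hc j i gj); apply: colored.
  apply/imsetP => -[k kU /tinj jk]; move: kU; rewrite -jk inE.
  by case/andP => _ /existsP[m /andP[jm]]; rewrite gj => gm; have := jmax m gm;
    rewrite /= leqNgt jm.
by rewrite -(valid_support _ vf) -(eqP (f0 j)) gj.
Qed.

Lemma growth_subset beta n :
  (forall S v, #|S| < n -> v \notin S -> #|pcolorings S| * beta <= #|pcolorings (v |: S)|) ->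
  forall S S', #|S| <= n -> S' \subset S ->
    #|pcolorings S'| * beta ^ #|S :\: S'| <= #|pcolorings S|.
Proof.
move=> step S S' Sn; have [m] := ubnP #|S :\: S'|; elim: m S' => // m IH S' mS' S'S.
have [D0 | [v]] := set_0Vmem (S :\: S').
  have -> : S' = S by apply/eqP; rewrite eqEsubset S'S -setD_eq0 D0 eqxx.
  by rewrite setDv cards0 muln1.
move=> vD; move: (vD); rewrite inE => /andP[vS' vS].
have sub : v |: S' \subset S by rewrite subUset sub1set vS.
have Dv : S :\: (v |: S') = (S :\: S') :\ v by rewrite setDDl setUC.
move: mS'; rewrite (cardsD1 v) vD add1n -Dv expnS ltnS => mS'.
apply: leq_trans (IH _ mS' sub); rewrite mulnA leq_mul2r step ?orbT //.
apply: leq_trans Sn; apply: leq_trans (subset_leq_card sub).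
by rewrite cardsU1 vS'.
Qed.

(** * The growth step *)

Definition repetitive_extensions S v :=
  [set f in extensions S v | [forall u, conflict v u ==> (f u != f v)] && ~~ good f].

Lemma repetitive_extensions_sub S v : v \notin S ->
  repetitive_extensions S v \subset
  \bigcup_(l < #|T|.+1 | r < l) \bigcup_(c : l.-tuple T | (c \in risky_cycles l v) && uniq c)
    \bigcup_(g | (l - r < #|repeats g|) &&
      [exists i, (tnth c i == v) && (i \in repeats g)]) fitting S v c g.
Proof.
move=> vS; apply/subsetP => f; rewrite inE => /and3P[fE /forallP fv fbad].
have nv u : conflict v u -> f u != f v by apply/implyP.
have [t [cu ce crep /mapP[u ut fvu]]] := extension_repetitive vS fE nv fbad.
have nconf : ~~ conflict v u by apply/negP => /nv; rewrite fvu eqxx.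
have [rl risky] := repetition_risky cu ce ut nconf.
have lT : size (v :: t) < #|T|.+1 by rewrite ltnS -(card_uniqP cu) max_card.
have [g [fg rg rep]] := exists_pattern (c := in_tuple (v :: t)) rl crep.
apply/bigcupP; exists (Ordinal lT) => //.
apply/bigcupP; exists (in_tuple (v :: t)); first by rewrite risky.
apply/bigcupP; exists g; last by rewrite inE fE.
rewrite rg; apply/existsP; exists ord0; rewrite eqxx /=.
have jl : (index u t).+1 < size (v :: t) by rewrite ltnS index_mem.
apply: (rep ord0 (Ordinal jl)) => //.
  rewrite /tnth /=; move: fE; rewrite inE => /andP[_ vf].
  by rewrite (valid_support _ vf) !inE eqxx.
by rewrite /tnth /= nth_index.
Qed.

(** In [beta ^ (l - r)], the powers of [B] offset all but one factor [B] of the cycle count, those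
    of [r ^ r.+1] offset the [r ^ l] patterns, and those of 2 make the sum over [l] geometric. *)
Let beta := 2 * r ^ r.+1 * B.

Lemma card_repetitive_extensions S v : 2 <= r -> 0 < B -> 0 < D -> D ^ r.+1 <= B ^ 3 ->
  v \notin S ->
  (forall S', S' \subset S -> #|pcolorings S'| * beta ^ #|S :\: S'| <= #|pcolorings S|) ->
  #|repetitive_extensions S v| <= B * #|pcolorings S|.
Proof.
move=> r2 B0 D0 DB vS grow; have r0 : 0 < r by apply: leq_trans r2.
have beta0 : 0 < beta by rewrite !muln_gt0 expn_gt0 r0.
apply: leq_trans (subset_leq_card (repetitive_extensions_sub vS)) _.
apply: leq_trans (leq_card_bigcup _ _) _.
pose b l := \sum_(c : l.-tuple T | (c \in risky_cycles l v) && uniq c)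
  \sum_(g | (l - r < #|repeats g|) && [exists i, (tnth c i == v) && (i \in repeats g)])
    #|fitting S v c g|.
apply: (@leq_trans (\sum_(l < #|T|.+1 | r < l) b l)).
  apply: leq_sum => l _; apply: leq_trans (leq_card_bigcup _ _) _.
  by apply: leq_sum => c _; apply: leq_card_bigcup.
apply: (geometric_sum (b := b)) => l rl.
have hb : b l * beta ^ (l - r) <= B ^ (l - r).+1 * (r ^ l * #|pcolorings S|).
  rewrite /b big_distrl /=.
  apply: leq_trans (leq_mul (card_risky_cycles v r2 B0 D0 DB rl) (leqnn _)).
  rewrite -sum_nat_const big_mkcondr; apply: leq_sum => c _; case: ifP => // cu.
  apply: (@leq_trans (\sum_(g : {ffun 'I_l -> 'I_r}) #|pcolorings S|)); last first.
    by rewrite sum_nat_const card_ffun !card_ord.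
  rewrite big_distrl big_mkcond /=; apply: leq_sum => g _;
    case: ifP => // /andP[gl /existsP[i /andP[/eqP ci iU]]].
  apply: leq_trans (card_fitting cu vS ci iU beta0 grow).
  by rewrite leq_mul2l leq_pexp2l ?orbT // -ltnS (ltn_predK gl).
have C0 : 0 < r ^ (r.+1 * (l - r)) * B ^ (l - r) by rewrite muln_gt0 !expn_gt0 r0 B0.
rewrite -(leq_pmul2r C0); apply: leq_trans (leq_trans _ hb) _.
  by rewrite /beta !expnMn -expnM -!mulnA.
have rr : r ^ l <= r ^ (r.+1 * (l - r)) by rewrite leq_pexp2l //; nia.
rewrite expnS -!mulnA leq_mul2l; apply/orP; right.
rewrite [leqRHS]mulnC [_ * B ^ _ in leqRHS]mulnC -mulnA.
by rewrite leq_mul2l leq_mul2r rr !orbT.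
Qed.

(** Of at least [D ^ d + B + B + beta] extensions per colouring, on average at most [D ^ d + B]
    create a conflict and at most [B] a repetitive cycle. *)
Lemma card_step S v : 2 <= r -> 0 < d -> 0 < B -> 0 < D -> D ^ r.+1 <= B ^ 3 ->
  (forall v, D ^ d + B + B + beta <= #|L v|) -> v \notin S ->
  (forall S', S' \subset S -> #|pcolorings S'| * beta ^ #|S :\: S'| <= #|pcolorings S|) ->
  #|pcolorings S| * beta <= #|pcolorings (v |: S)|.
Proof.
move=> r2 d0 B0 D0 DB Lbig vS grow.
have ext_le := card_extensions vS.
have rep_le := card_repetitive_extensions r2 B0 D0 DB vS grow.
pose conflicting := \bigcup_(u | conflict v u) [set f in extensions S v | f u == f v].
have conf_le : #|conflicting| <= (D ^ d + B) * #|pcolorings S|.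
  apply: leq_trans (leq_card_bigcup _ _) _.
  apply: (@leq_trans (\sum_(u in [set u | conflict v u]) #|pcolorings S|)).
    rewrite [leqRHS](eq_bigl (conflict v)) => [|u]; last by rewrite inE.
    apply: leq_sum => u /andP[uv _]; apply: card_conflicting_extensions => //.
    by rewrite eq_sym.
  by rewrite sum_nat_const leq_mul2r card_conflict ?orbT.
have cover : extensions S v \subset
    pcolorings (v |: S) :|: conflicting :|: repetitive_extensions S v.
  apply/subsetP => f fE; rewrite !in_setU [f \in repetitive_extensions _ _]inE fE /=.
  have vf : valid (v |: S) f by move: fE; rewrite inE => /andP[].
  rewrite [f \in pcolorings _]inE vf andbT; case: (good f) => //=; rewrite andbT.
  case: (boolP [forall u, _]); rewrite ?orbT // => /forallPn[u]; rewrite negb_imply negbK.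
  by case/andP => vu fuv; rewrite orbF; apply/bigcupP; exists u; rewrite // inE fE.
have := subset_leq_card cover.
have := (leq_card_setU (pcolorings (v |: S) :|: conflicting) (repetitive_extensions S v)).1.
have := (leq_card_setU (pcolorings (v |: S)) conflicting).1.
have : #|pcolorings S| * (D ^ d + B + B + beta) <= #|pcolorings S| * #|L v|.
  by rewrite leq_mul2l Lbig orbT.
move: ext_le rep_le conf_le.
move: (#|L v|) (#|_ :|: _ :|: _|) (#|_ :|: _|) (#|pcolorings S|) => x1 x2 x3 N.
rewrite !mulnDr !mulnDl [B * N]mulnC [_ * N]mulnC; lia.
Qed.

Lemma pcolorings_exist : 2 <= r -> 0 < d -> 0 < B -> 0 < D -> D ^ r.+1 <= B ^ 3 ->
  (forall v, D ^ d + B + B + beta <= #|L v|) -> 0 < #|pcolorings [set: T]|.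
Proof.
move=> r2 d0 B0 D0 DB Lbig; have r0 : 0 < r by apply: leq_trans r2.
have step S v : v \notin S -> #|pcolorings S| * beta <= #|pcolorings (v |: S)|.
  (* Strong induction on [#|S|]: growth on smaller sets supplies the erasure bound for [S]. *)
  have [n] := ubnP #|S|; elim: n S v => // n IH S v Sn vS.
  apply: card_step => // S' S'S; apply: (growth_subset IH) => //.
apply: leq_trans (growth_subset (n := #|T|) (fun S v _ => @step S v) (max_card _) (sub0set _)).
rewrite muln_gt0 expn_gt0 !muln_gt0 expn_gt0 r0 B0 /= andbT.
apply/card_gt0P; exists [ffun=> None]; rewrite inE; apply/andP; split; last first.
  by apply/forallP => x; rewrite ffunE inE.
apply/goodP; split=> [u w _ _|c _ _]; first by rewrite ffunE.
have pm0 : pmap ([ffun=> None] : pcol) c = [::] by elim: c => //= x c ->; rewrite ffunE.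
by rewrite /repetitive pm0.
Qed.

End Counting.

(** * From counting to choosability *)

Lemma r_acyclic_choosable_counting k : 2 <= r -> 0 < d -> 0 < B -> 0 < D -> D ^ r.+1 <= B ^ 3 ->
  D ^ d + B + B + 2 * r ^ r.+1 * B <= k -> r_acyclic_choosable r e k.
Proof.
move=> r2 d0 B0 D0 DB kbig L Lk.
(* Counting needs a finite colour type, so all lists are placed in ['I_m.+1]. *)
pose m := \max_(v : T) \max_(a <- L v) a.
have Lm v a : a \in L v -> a < m.+1.
  move=> aL; rewrite ltnS; apply: leq_trans (leq_bigmax v).
  exact: leq_bigmax_seq.
pose L' v := [set a : 'I_m.+1 | (a : nat) \in L v].
have cardL' v : k <= #|L' v|.
  apply: leq_trans (Lk v) _.
  have sub : {subset L v <= map (@nat_of_ord m.+1) (enum (L' v))}.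
    move=> a aL; apply/mapP; exists (Ordinal (Lm _ _ aL)) => //.
    by rewrite mem_enum inE.
  by have := uniq_leq_size (fset_uniq _) sub; rewrite size_map -cardE.
have /card_gt0P[f] : 0 < #|pcolorings L' [set: T]|.
  by apply: pcolorings_exist => // v; apply: leq_trans kbig (cardL' v).
rewrite inE => /andP[/goodP[fH frep] fv].
have full v : exists2 a, f v = Some a & (a : nat) \in L v.
  have := valid_support v fv; rewrite inE; case E: (f v) => [a|] // _.
  by exists a; rewrite //; have := valid_list fv E; rewrite inE.
pose h v := if f v is Some a then (a : nat) else 0.
have hE v : exists2 a : 'I_m.+1, f v = Some a & h v = a.
  by have [a fva _] := full v; exists a; rewrite // /h fva.
exists h; split; first by move=> v; have [a fva aL] := full v; rewrite /h fva.
split=> [u v euv | c [c3 cu ce]].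
  have [a fua ->] := hE u; have [b fvb ->] := hE v; apply/eqP => /val_inj ab.
  have uv : conflict u v.
    rewrite /conflict; case: eqP euv => [-> | _ euv]; first by rewrite eirr.
    apply/orP; left; apply/ballP; exists [:: v]; rewrite /= ?eqxx ?andbT //.
  by have := fH u v uv; rewrite fua fvb ab => /(_ erefl).
have := frep c ce cu; rewrite /repetitive.
have -> : map h c = map val (pmap f c).
  by elim: (c) => //= x s ->; have [a -> ->] := hE x.
rewrite undup_map_inj; last exact: val_inj.
rewrite size_map size_pmap.
have -> : count (fun x => isSome (f x)) c = size c.
  by apply/eqP; rewrite -all_count; apply/allP => x _; have [a -> _] := hE x.
(* For a total colouring, not being repetitive is the required bound; truncated subtraction covers
   cycles shorter than [r]. *)
rewrite -leqNgt; have arith p q : p <= q + (p - r) -> minn p r <= q by lia.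
exact: arith.
Qed.

End Walks.

(* Real exponents and the final bound *)
From Stdlib Require Import Reals Lra.

Lemma nat_powE m n : Nat.pow m n = expn m n.
Proof. by elim: n => // n IH; rewrite expnS -IH. Qed.

Lemma cube_root_approx (D r : nat) : 0 < D ->
  exists B : nat, [/\ 0 < B, expn D r.+1 <= expn B 3 &
    (INR B <= 2 * Rpower (INR D) ((INR r + 1) / 3))%R].
Proof.
move=> D0; set x := Rpower _ _.
have D1 : (1 <= INR D)%R by apply: (le_INR 1); apply/leP.
have x1 : (1 <= x)%R.
  rewrite -(Rpower_O (INR D)); last lra.
  apply: Rle_Rpower => //; have := pos_INR r; lra.
have x3 : (x ^ 3 = INR (expn D r.+1))%R.
  rewrite -nat_powE pow_INR -Rpower_pow; last exact: exp_pos.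
  rewrite Rpower_mult -(Rpower_pow r.+1); last lra.
  by congr Rpower; rewrite [INR 3]/= [INR r.+1]S_INR; field.
have [Bup Blo] := archimed x.
(* [B] is [up x], which satisfies [x < up x <= x + 1 <= 2 * x] because [x >= 1]. *)
have up0 : (0 <= up x)%Z by apply: le_IZR; lra.
exists (Z.to_nat (up x)).
have EB : INR (Z.to_nat (up x)) = IZR (up x) by rewrite INR_IZR_INZ Znat.Z2Nat.id.
split.
- by apply/ltP/INR_lt; rewrite EB /=; lra.
- apply/leP/INR_le; rewrite -x3 -[expn _ 3]nat_powE pow_INR EB.
  by apply: pow_incr; lra.
- by rewrite EB; lra.
Qed.

(* A_r^l(G) <= x  is expressed as: some k <= x has G r-acyclically k-choosable
   (A_r^l(G) is the least such k). *)
Theorem theorem9 :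
  forall r : nat, 4 <= r ->
  exists c : R,
  forall (T : finType) (e : rel T), simple_graph e ->
  3 <= max_degree e ->
  exists k : nat, r_acyclic_choosable r e k /\
    (INR k <= INR (max_degree e ^ (r./2))
              + c * Rpower (INR (max_degree e)) ((INR r + 1) / 3))%R.
Proof.
(* [C * B] collects [B + B] and [beta]; the outer 2 comes from the rounding of [B]. *)
move=> r r4; pose C := 2 + 2 * expn r r.+1; exists (2 * INR C)%R => T e [esym eirr] D3.
have D0 : 0 < max_degree e by apply: leq_trans D3.
have [B [B0 DB Bx]] := cube_root_approx r D0.
exists (expn (max_degree e) r./2 + C * B); split.
  apply: (r_acyclic_choosable_counting esym eirr _ _ _ B0 D0 DB).
  - by move=> v; apply: (leq_bigmax v).
  - exact: leq_trans r4.
  - by rewrite half_gt0; apply: leq_trans r4.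
  - by rewrite /C mulnDl [2 * B]mul2n -addnn !addnA.
rewrite plus_INR mult_INR nat_powE; have := pos_INR C; nra.
Qed.
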